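(* Let $G$ be a graph with $n$ vertices and let $\lambda\in\mathbb{N}$. Then $$\mathrm{afs}(G;\lambda)=\frac{n\lambda}{\lambda+1}+\frac{1}{(\lambda+1)^2}\left.\frac{d}{dp}\log\mathrm{FC}_{\lambda}(G;p)\right|_{p=(\lambda+1)^{-1}}.$$
   Context: $G=(V,E)$ is a graph with $n=|V|$ vertices, $\lambda$ is a positive integer (the number of available colours), $[\lambda]=\{1,\dots,\lambda\}$, and $N_G(v)$ is the set of vertices adjacent to $v$ in $G$. A partial $\lambda$-assignment of $G$ is a function $f:W\to[\lambda]$ with $W\subseteq V$; write $\operatorname{dom} f=W$ ($W=\emptyset$ and $W=V$ are allowed). A $\lambda$-colouring of $G$ is a partial $\lambda$-assignment with domain $V$ in which adjacent vertices have different colours. A vertex $v\notin\operatorname{dom} f$ is immediately $\lambda$-forced by $f$ if $|\{f(w): w\in N_G(v)\cap\operatorname{dom} f\}|=\lambda-1$; in that case $f;v$ denotes the extension of $f$ to $(\operatorname{dom} f)\cup\{v\}$ that gives $v$ the unique colour of $[\lambda]$ not appearing on its neighbours in $\operatorname{dom} f$. We say $f$ (eventually) forces a $\lambda$-colouring of $G$ if there is a (possibly empty) sequence of such steps $f=f_0$, $f_i=f_{i-1};v_i$ ($1\le i\le k$, with $v_i$ immediately $\lambda$-forced by $f_{i-1}$) such that $f_k$ is a $\lambda$-colouring of $G$. For $C\subseteq V$, $\mathrm{fcol}(G,C;\lambda)$ is the number of partial $\lambda$-assignments $f$ with $\operatorname{dom} f=C$ that force a $\lambda$-colouring of $G$.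 For $0\le p\le\lambda^{-1}$, $\mathrm{FC}_{\lambda}(G;p)$ is the probability that a random partial $\lambda$-assignment forces a $\lambda$-colouring of $G$, where independently each vertex receives each specific colour with probability $p$ and remains uncoloured with probability $1-\lambda p$. For fixed $\lambda$ it is a polynomial in $p$, the forced $\lambda$-colouring polynomial of $G$: $$\mathrm{FC}_{\lambda}(G;p)=\sum_{C\subseteq V}\mathrm{fcol}(G,C;\lambda)\,p^{|C|}(1-\lambda p)^{n-|C|}.$$ The average forcing size $\mathrm{afs}(G;\lambda)$ of $G$ for $\lambda$ colours is the average size of the domain of a partial $\lambda$-assignment that forces a $\lambda$-colouring of $G$: $$\mathrm{afs}(G;\lambda)=\frac{\sum_{C\subseteq V}\mathrm{fcol}(G,C;\lambda)\,|C|}{\sum_{C\subseteq V}\mathrm{fcol}(G,C;\lambda)}.$$ Here $\log$ is the natural logarithm. *)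

(* Defs.v *)
From mathcomp Require Import all_boot all_order all_algebra.
From mathcomp Require Import all_reals.

Set Implicit Arguments.
Unset Strict Implicit.
Unset Printing Implicit Defensive.

Import Order.TTheory GRing.Theory Num.Theory.
Local Open Scope ring_scope.

(* Finite simple graphs; the empty graph is allowed. *)
Record sgraph := SGraph {
  vertex :> finType;
  edge : rel vertex;
  edge_sym : symmetric edge;
  edge_irrefl : irreflexive edge }.

Section ForcedColouring.
Variables (G : sgraph) (lam : nat).

(* A partial assignment of lam colours; [None] marks an uncoloured vertex, and
   the colours 1, ..., lam are represented by the elements of 'I_lam. *)
Definition passign : finType := {ffun G -> option 'I_lam}.

Definition dom (f : passign) : {set G} := [set v | f v != None]%SET.

Definition is_colouring (f : passign) : bool :=
  (dom f == [set: G]%SET) &&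
  [forall v, forall w, edge v w ==> (f v != f w)].

Definition nbr_colours (f : passign) (v : G) : {set 'I_lam} :=
  [set c | [exists w, edge v w && (f w == Some c)]]%SET.

Definition immediately_forced (f : passign) (v : G) : bool :=
  (v \notin dom f) && (#|nbr_colours f v| == lam.-1).

(* The extension f;v. When v is immediately forced and 0 < lam, exactly one
   colour is missing from the neighbours of v, so [pick] returns it. *)
Definition force (f : passign) (v : G) : passign :=
  [ffun w => if w == v then [pick c | c \notin nbr_colours f v] else f w].

Definition force_step : rel passign :=
  [rel f g | [exists v, immediately_forced f v && (g == force f v)]].

Definition forces (f : passign) : bool :=
  [exists g, connect force_step f g && is_colouring g].

Definition fcol (C : {set G}) : nat :=
  #|[set f : passign | (dom f == C) && forces f]%SET|.

Variable R : realType.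

(* The probability that a random partial assignment f has the given value,
   the vertices being coloured independently. *)
Definition passign_prob (p : R) (f : passign) : R :=
  \prod_(v : G) (if f v is Some _ then p else 1 - lam%:R * p).

Definition FC (p : R) : R := \sum_(f : passign | forces f) passign_prob p f.

Definition afs : R :=
  (\sum_(C : {set G}) (fcol C)%:R * #|C|%:R) / (\sum_(C : {set G}) (fcol C)%:R).

Lemma passign_probE (p : R) (f : passign) :
  passign_prob p f = p ^+ #|dom f| * (1 - lam%:R * p) ^+ (#|G| - #|dom f|).
Proof.
rewrite /passign_prob (bigID (mem (dom f))) /=; congr (_ * _).
  rewrite -prodr_const; apply: eq_bigr => v; rewrite inE.
  by case: (f v).
have -> : (#|G| - #|dom f|)%N = #|(~: dom f)%SET| by rewrite [RHS]cardsCs finset.setCK.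
rewrite -prodr_const; apply: eq_big => v; first by rewrite !inE.
by rewrite inE; case: (f v).
Qed.

Lemma passign_prob_sum1 (p : R) : \sum_(f : passign) passign_prob p f = 1.
Proof.
rewrite /passign_prob.
rewrite -(bigA_distr_bigA
  (fun _ (o : option 'I_lam) => if o is Some _ then p else 1 - lam%:R * p)).
apply: big1 => v _; rewrite (bigD1 None) //=.
rewrite (eq_bigr (fun=> p)); last by case.
rewrite sumr_const.
have -> : #|[pred i : option 'I_lam | i != None]| = lam.
  by rewrite cardC1 card_option card_ord.
by rewrite mulr_natl subrK.
Qed.

Lemma FCE (p : R) :
  FC p = \sum_(C : {set G})
    (fcol C)%:R * p ^+ #|C| * (1 - lam%:R * p) ^+ (#|G| - #|C|).
Proof.
rewrite /FC (partition_big dom predT) //=; apply: eq_bigr => C _.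
rewrite -mulrA mulr_natl -sumr_const; apply: eq_big => f.
  by rewrite inE andbC.
by case/andP=> _ /eqP <-; rewrite passign_probE.
Qed.

End ForcedColouring.

Arguments passign_prob {G lam R} p f.
Arguments FC G lam {R} p.
Arguments afs G lam R : clear implicits.

(* Main.v *)
Require Import Defs.
From mathcomp Require Import all_boot all_order all_algebra.
From mathcomp Require Import all_classical all_reals all_analysis.
From mathcomp Require Import ring.
Import Order.TTheory GRing.Theory Num.Theory.
Local Open Scope ring_scope.

(** With l = lam and n = #|G|, the polynomial FC p is the sum over C of
    fcol C * p ^ #|C| * (1 - l p) ^ (n - #|C|).  The point p0 = 1 / (l + 1) is
    where 1 - l p = p: each colour and the absence of a colour are equally
    likely there, so every partial assignment has the same probability p0 ^ n.
    Write S for the number of assignments that force a colouring and T for the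
    sum of their domain sizes, so that the average forcing size is T / S.

    Uniformity gives FC p0 = p0 ^ n * S ([FC_uniform]); moreover S > 0, because
    a colouring forces itself.  For the derivative, the logarithmic derivative
    of p ^ a * (1 - l p) ^ b at p0 is (l + 1) * (a - l b)
    ([is_derive_monomial_uniform]), which for a = #|C| and b = n - #|C| equals
    (l + 1) * ((l + 1) * #|C| - l n), affine in #|C|.  Summing over C,
    FC' p0 = p0 ^ n * (l + 1) * ((l + 1) * T - l n S) ([is_derive_FC_uniform]).
    In the quotient FC' p0 / FC p0 the factor p0 ^ n cancels, leaving
    (l + 1) ^ 2 * T / S - (l + 1) * l n, and the formula follows on dividing
    by (l + 1) ^ 2. *)

Lemma is_derive_sum_fin {K : numFieldType} {V W : normedModType K} (I : finType)
    (h : I -> V -> W) (x v : V) (dh : I -> W) :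
  (forall i, is_derive x v (h i) (dh i)) ->
  is_derive x v (fun y => \sum_i h i y) (\sum_i dh i).
Proof.
move=> hD; have -> : (fun y => \sum_i h i y) = \sum_(i < #|I|) h (enum_val i).
  by apply/funext => y; rewrite fct_sumE [LHS]big_enum_val.
by rewrite [X in is_derive _ _ _ X]big_enum_val; exact: is_derive_sum.
Qed.

Section UniformPoint.
Context {R : realType}.
Implicit Types l : R.

(** This fixed-point property of p |-> 1 - l p is what makes all partial
    assignments equiprobable at 1 / (l + 1). *)
Lemma uniform_point_fixed l : 0 <= l -> 1 - l * (l + 1)^-1 = (l + 1)^-1.
Proof. by move=> l0; field; rewrite gt_eqF// ltr_wpDl. Qed.

(** Both factors take the value 1 / (l + 1) at this point, so the truncated
    exponents produced by differentiation can be restored by the same factor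
    l + 1, also when an exponent is 0. *)
Lemma is_derive_monomial_uniform l (a b : nat) : 0 <= l ->
  is_derive (l + 1)^-1 1 (fun p : R => p ^+ a * (1 - l * p) ^+ b)
    ((l + 1)^-1 ^+ (a + b) * ((l + 1) * (a%:R - l * b%:R))).
Proof.
move=> l0; have l1 : l + 1 != 0 by rewrite gt_eqF// ltr_wpDl.
have qD : is_derive (l + 1)^-1 1 (fun p : R => 1 - l * p) (- l).
  have D := is_deriveB (is_derive_cst (1 : R) (l + 1)^-1 1)
    (is_deriveZ l (is_derive_id (l + 1)^-1 (1 : R))).
  by apply: is_derive_eq D _; rewrite sub0r /GRing.scale /= mulr1.
have -> : (fun p : R => p ^+ a * (1 - l * p) ^+ b) =
    id ^+ a * (fun p => 1 - l * p) ^+ b by apply/funext => p; rewrite !fctE.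
have D := is_deriveM (is_deriveX a (is_derive_id (l + 1)^-1 (1 : R)))
  (is_deriveX b qD).
have predX k : k%:R * (l + 1)^-1 ^+ k.-1 = k%:R * ((l + 1) * (l + 1)^-1 ^+ k).
  by case: k => [|k]; rewrite ?mul0r //= exprS mulVKf.
apply: is_derive_eq D _.
rewrite /GRing.scale /= !fctE uniform_point_fixed // !predX exprD; ring.
Qed.

End UniformPoint.

Section ForcedColouringPolynomial.
Context {R : realType} {G : sgraph} {lam : nat}.
Let l : R := lam%:R.
Let S : R := \sum_(C : {set G}) (fcol lam C)%:R.
Let T : R := \sum_(C : {set G}) (fcol lam C)%:R * #|C|%:R.

Lemma FC_uniform : FC G lam (l + 1)^-1 = (l + 1)^-1 ^+ #|G| * S.
Proof.
rewrite FCE mulr_sumr; apply: eq_bigr => C _.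
by rewrite uniform_point_fixed ?ler0n // -mulrA -exprD subnKC ?max_card // mulrC.
Qed.

Lemma is_derive_FC_uniform :
  is_derive (l + 1)^-1 1 (FC G lam : R -> R)
    ((l + 1)^-1 ^+ #|G| * ((l + 1) * ((l + 1) * T - l * #|G|%:R * S))).
Proof.
have -> : (FC G lam : R -> R) = fun p => \sum_(C : {set G})
    (fcol lam C)%:R * (p ^+ #|C| * (1 - l * p) ^+ (#|G| - #|C|)).
  by apply/funext => p; rewrite FCE; apply: eq_bigr => C _; rewrite mulrA.
have D := is_derive_sum_fin _ _ _ _ _ (fun C : {set G} =>
  is_deriveZ ((fcol lam C)%:R : R)
    (is_derive_monomial_uniform l #|C| (#|G| - #|C|) (ler0n _ lam))).
apply: is_derive_eq D _.
rewrite /T /S !mulr_sumr -sumrB !mulr_sumr; apply: eq_bigr => C _.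
rewrite /GRing.scale /= subnKC ?max_card // natrB ?max_card //; ring.
Qed.

Lemma colouring_forces (f : passign G lam) : is_colouring f -> forces f.
Proof. by move=> fcolg; apply/existsP; exists f; rewrite connect0. Qed.

Lemma sum_fcol_gt0 : (exists f : passign G lam, is_colouring f) -> 0 < S.
Proof.
case=> f /colouring_forces forces_f.
rewrite /S (bigD1 (dom f)) //= ltr_pwDl ?sumr_ge0 // ltr0n.
by apply/card_gt0P; exists f; rewrite inE eqxx.
Qed.

End ForcedColouringPolynomial.

Theorem theorem11 (R : realType) (G : sgraph) (lam : nat)
    (lam_gt0 : (0 < lam)%N)
    (G_colourable : exists f : passign G lam, is_colouring f) :
  let p0 : R := (lam%:R + 1)^-1 in
  [/\ 0 < FC G lam p0,
      derivable (fun p : R => ln (FC G lam p)) p0 1 &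
      afs G lam R = #|G|%:R * lam%:R / (lam%:R + 1)
        + ((lam%:R + 1) ^+ 2)^-1 * derive1 (fun p : R => ln (FC G lam p)) p0].
Proof.
move=> p0; have l1 : 0 < lam%:R + 1 :> R by rewrite ltr_wpDl.
have S0 := @sum_fcol_gt0 R G lam G_colourable.
have p0X : 0 < p0 ^+ #|G| by rewrite exprn_gt0 // invr_gt0.
have FC0 : 0 < FC G lam p0 by rewrite FC_uniform mulr_gt0.
have lnD := is_derive1_comp (is_derive1_ln FC0) (@is_derive_FC_uniform R G lam).
split=> //.
rewrite derive1E (@derive_val _ _ _ _ _ _ _ lnD) FC_uniform /afs.
by rewrite /p0; field; rewrite (gt_eqF S0) (gt_eqF p0X) gt_eqF.
Qed.
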